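(* Let $G_1$ be an $r_1$-regular graph on $n_1$ vertices and $m_1$ edges, and $G_2$ an arbitrary graph on $n_2$ vertices. Then $$\begin{aligned}\phi\left(L(G_1\dot{\vee} G_2);x\right)={}&x\cdot(x-2)^{m_1-n_1}\cdot\Big(x^2-(2+r_1+n_1+n_2)x+2n_1+2n_2+n_1r_1\Big)\\&\cdot\prod_{i=2}^{n_2}\Big(x-n_1-\mu_i(G_2)\Big)\cdot\prod_{i=2}^{n_1}\Big(x^2-(2+r_1+n_2)x+2n_2+\mu_i(G_1)\Big).\end{aligned}$$
   Context: All graphs are finite, simple and undirected, with at least one vertex. For a graph $G$ on $n$ vertices, $L(G)=D(G)-A(G)$ is its Laplacian matrix ($D(G)$ the diagonal matrix of vertex degrees, $A(G)$ the adjacency matrix), with eigenvalues $0=\mu_1(G)\le\mu_2(G)\le\cdots\le\mu_n(G)$. For an $n\times n$ matrix $M$, $\phi(M;x)=\det(xI_n-M)$. The subdivision graph $\mathcal{S}(G)$ is obtained from $G$ by inserting a new vertex into every edge of $G$. For vertex-disjoint graphs $G_1,G_2$, the subdivision-vertex join $G_1\dot{\vee}G_2$ is the graph obtained from $\mathcal{S}(G_1)$ and $G_2$ by joining every vertex of $V(G_1)$ (the original vertices) with every vertex of $V(G_2)$. The identity is understood as an identity of rational functions in $x$ (the exponent $m_1-n_1$ may be negative). *)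

(* Defs.v *)
From HB Require Import structures.
From mathcomp Require Import all_boot all_order all_algebra.
From mathcomp Require Import polyrcf.

Set Implicit Arguments.
Unset Strict Implicit.
Unset Printing Implicit Defensive.

Import Order.TTheory GRing.Theory Num.Theory.

(* Possibly empty; nonemptiness is a separate hypothesis where it is needed. *)
Record sgraph := SGraph {
  vertex :> finType;
  adj : rel vertex;
  adj_sym : symmetric adj;
  adj_irrefl : irreflexive adj
}.

Definition degree (G : sgraph) (v : G) : nat := #|[set w : G | adj v w]|.

Definition regular (G : sgraph) (r : nat) : Prop := forall v : G, degree v = r.

Definition edges (G : sgraph) : {set {set G}} :=
  [set e | [exists v : G, exists w : G, adj v w && (e == [set v; w])]].

Section Subdivision.
Variable G : sgraph.

(* [inr e] is the new vertex inserted into the edge [e]. *)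
Definition subdiv_vertex : finType := (G + {e : {set G} | e \in edges G})%type.

Definition subdiv_adj : rel subdiv_vertex := fun a b =>
  match a, b with
  | inl v, inr e => v \in val e
  | inr e, inl v => v \in val e
  | _, _ => false
  end.

Lemma subdiv_adj_sym : symmetric subdiv_adj.
Proof. by case=> [v|e] [w|f]. Qed.

Lemma subdiv_adj_irrefl : irreflexive subdiv_adj.
Proof. by case. Qed.

Definition subdivision : sgraph := SGraph subdiv_adj_sym subdiv_adj_irrefl.

End Subdivision.

Section SubdivisionVertexJoin.
Variables G1 G2 : sgraph.

Definition svjoin_vertex : finType := (subdivision G1 + G2)%type.

Definition svjoin_adj : rel svjoin_vertex := fun a b =>
  match a, b with
  | inl u, inl v => adj u v
  | inr u, inr v => adj u v
  | inl (inl _), inr _ => true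
  | inr _, inl (inl _) => true
  | _, _ => false
  end.

Lemma svjoin_adj_sym : symmetric svjoin_adj.
Proof. by case=> [[u|e]|u] [[v|f]|v] //=; apply: adj_sym. Qed.

Lemma svjoin_adj_irrefl : irreflexive svjoin_adj.
Proof. by case=> [[u|e]|u] //=; apply: adj_irrefl. Qed.

Definition subdiv_vertex_join : sgraph :=
  SGraph svjoin_adj_sym svjoin_adj_irrefl.

End SubdivisionVertexJoin.

Local Open Scope ring_scope.

Section Laplacian.
Variables (R : rcfType) (G : sgraph).

Definition adjacency_mx : 'M[R]_#|G| :=
  \matrix_(i, j) (adj (enum_val i) (enum_val j))%:R.

Definition degree_mx : 'M[R]_#|G| :=
  diag_mx (\row_i (degree (enum_val i))%:R).

Definition laplacian : 'M[R]_#|G| := degree_mx - adjacency_mx.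

(* [rootsR p] lists the distinct roots of [p] in increasing order and [mup a p]
   is the multiplicity of the root [a], so this is the nondecreasing list of
   the eigenvalues of the Laplacian with algebraic multiplicity. *)
Definition laplacian_spectrum : seq R :=
  let p := char_poly laplacian in
  flatten [seq nseq (mup a p) a | a <- rootsR p].

(* 1-based: [laplacian_eigenvalue 1] is the least eigenvalue. *)
Definition laplacian_eigenvalue (i : nat) : R :=
  nth 0 laplacian_spectrum i.-1.

End Laplacian.

Notation "p %:F" := (tofrac p) (format "p %:F") : ring_scope.

(* Main.v *)
Require Import Defs.
From mathcomp Require Import all_boot all_order all_algebra.
From mathcomp Require Import all_fingroup.
From mathcomp Require Import complex polyrcf.
From mathcomp Require Import ring lra.

(* Let B be the vertex-edge incidence matrix of the r-regular graph G1, so that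
   B B^T = 2 r I - L(G1), and put b = x - 2, q = x - n1, a = x - r - n2 and
   y = a b - 2 r.  Eliminating the edge vertices and the vertices of G2 from
   x I - L leaves the Schur complement P - (n2 / q) J with b P = y I + L(G1);
   here (q I - L(G2))^-1 is only needed on the all-ones vector, where it acts as
   1 / q.  The all-ones vector is also an eigenvector of P, for y / b, so the
   rank-one term only contributes the factor 1 - n1 n2 b / (q y).  The remaining
   determinants are the characteristic polynomials of the Laplacians at q and
   - y; these split over a real closed field, and 0 is the least Laplacian
   eigenvalue of a nonempty graph. *)

Import Order.TTheory GRing.Theory Num.Theory.
Local Open Scope ring_scope.

Set Implicit Arguments.
Unset Strict Implicit.
Unset Printing Implicit Defensive.

(** * The spectrum of a Laplacian *)

Lemma char_poly_conj (K : fieldType) n (P D : 'M[K]_n) :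
  P \in unitmx -> char_poly (invmx P *m D *m P) = char_poly D.
Proof.
move=> Pu; pose f (B : 'M[K]_n) := map_mx (@polyC K) B.
have fPK : f (invmx P) *m f P = 1%:M by rewrite /f -map_mxM mulVmx // map_mx1.
have -> : char_poly (invmx P *m D *m P)
    = \det (f (invmx P) *m char_poly_mx D *m f P).
  congr (\det _); rewrite /char_poly_mx mulmxBr mulmxBl /f -!map_mxM.
  by rewrite mul_mx_scalar -scalemxAl fPK scalemx1.
by rewrite !det_mulmx mulrAC -det_mulmx fPK det1 mul1r.
Qed.

(** Over [R[i]] the matrix is Hermitian, hence unitarily diagonalizable with real diagonal. The
    resulting factorization descends to [R] because the embedding of polynomial rings is
    injective. *)
Lemma char_poly_symmetric_split (R : rcfType) n (M : 'M[R]_n) :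
  M^T = M -> exists s : seq R, char_poly M = \prod_(a <- s) ('X - a%:P).
Proof.
move=> Msym; pose c := real_complex R; pose A : 'M[R[i]]_n := map_mx c M.
have Aherm : A \is hermsymmx.
  apply: realsym_hermsym.
    apply/is_hermitianmxP/matrixP => i j.
    by rewrite expr0 scale1r !mxE -[in LHS]Msym mxE.
  by apply/mxOverP => i j; rewrite mxE /c complex_real.
have Areal := hermitian_spectral_diag_real Aherm.
have /orthomx_spectralP AE := hermitian_normalmx Aherm.
exists [seq complex.Re (spectral_diag A 0 i) | i <- enum 'I_n].
apply: (map_poly_inj (real_complex R)); rewrite map_char_poly -/A {1}AE.
rewrite char_poly_conj ?spectral_unit //.
rewrite char_poly_trig ?diag_mx_is_trig // rmorph_prod big_map big_enum /=.
apply: eq_bigr => i _; rewrite rmorphB /= map_polyX map_polyC /=.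
by rewrite mxE eqxx RRe_real // (mxOverP Areal).
Qed.

Lemma laplacian_tr (R : rcfType) (G : sgraph) : (laplacian R G)^T = laplacian R G.
Proof.
rewrite /laplacian linearB /= tr_diag_mx; congr (_ - _).
by apply/matrixP => i j; rewrite !mxE adj_sym.
Qed.

Lemma laplacian_spectrum_sorted (R : rcfType) (G : sgraph) :
  sorted <=%R (laplacian_spectrum R G).
Proof.
rewrite /laplacian_spectrum; set p := char_poly _.
have : sorted <%R (rootsR p) by exact: sorted_roots.
elim: (rootsR p) => //= a s IHs asP.
have sS := path_sorted asP.
have a_min : {in flatten [seq nseq (mup b p) b | b <- s], forall b, a <= b}.
  move=> b /flatten_mapP [b' b's]; rewrite mem_nseq => /andP[_ /eqP ->].
  by move/(order_path_min lt_trans)/allP/(_ b' b's)/ltW: asP.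
elim: (mup a p) => [|k IHk] /=; first exact: IHs.
rewrite path_min_sorted //; apply/allP => b; rewrite mem_cat mem_nseq.
by case/orP => [/andP[_ /eqP ->]|/a_min].
Qed.

(** Real roots taken with multiplicity account for the whole polynomial because it splits over [R]:
    each [a] occurs equally often in a splitting list [s] and in the spectrum. *)
Lemma char_poly_laplacian (R : rcfType) (G : sgraph) :
  char_poly (laplacian R G) = \prod_(a <- laplacian_spectrum R G) ('X - a%:P).
Proof.
have [s sE] := char_poly_symmetric_split (laplacian_tr R G).
rewrite {1}sE; apply: perm_big; apply/allP => a _ /=; apply/eqP.
rewrite /laplacian_spectrum; set p := char_poly _.
have p0 : p != 0 by rewrite monic_neq0 // char_poly_monic.
rewrite -mu_prod_XsubC -sE -/p count_flatten -map_comp sumnE big_map.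
(* Among the constant blocks of the spectrum, only that of [a] itself contains [a]. *)
rewrite (eq_bigr (fun b => if b == a then mup a p else 0%N)); last first.
  move=> b _ /=; rewrite count_nseq /=.
  by case: eqP => [->|] /=; rewrite ?mul1n ?mul0n.
have [a_root|aNroot] := boolP (a \in rootsR p).
  rewrite (bigD1_seq a) ?uniq_roots //= eqxx big1 ?addn0 // => b.
  by move/negPf ->.
rewrite big1_seq => [|b /= b_root]; last first.
  by case: eqP aNroot => // <-; rewrite b_root.
rewrite mupNroot //; apply: contra aNroot => pa.
by rewrite -(roots_on_rootsR p0) pa.
Qed.

Lemma sum_enum_val (V : nmodType) (T : finType) (F : T -> V) :
  \sum_(i < #|T|) F (enum_val i) = \sum_x F x.
Proof.
by rewrite [RHS](reindex (@enum_val T T)) //; exact/onW_bij/enum_val_bij.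
Qed.

Lemma sum_adj (R : pzSemiRingType) (G : sgraph) (x : G) :
  \sum_(y : G) (adj x y)%:R = (degree x)%:R :> R.
Proof.
rewrite /degree -sum1_card natr_sum [RHS]big_mkcond; apply: eq_bigr => y _ /=.
by rewrite inE; case: (adj x y).
Qed.

Lemma laplacian_mul_ones (R : rcfType) (G : sgraph) :
  laplacian R G *m const_mx 1 = 0 :> 'cV_#|G|.
Proof.
apply/matrixP => i j; rewrite mulmxBl mul_diag_mx !mxE mulr1.
under eq_bigr do rewrite !mxE mulr1.
by rewrite (sum_enum_val (fun y => (adj (enum_val i) y)%:R)) sum_adj subrr.
Qed.

(* The row of [v *m laplacian] at an entry of [v] of maximal modulus, as in
   Gershgorin's theorem. *)
Lemma laplacian_root_ge0 (R : rcfType) (G : sgraph) a :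
  root (char_poly (laplacian R G)) a -> 0 <= a.
Proof.
rewrite -eigenvalue_root_char => /eigenvalueP [v vL v0].
have [j vj0] : exists j, v 0 j != 0.
  apply/existsP; apply: contraNT v0; rewrite negb_exists => /forallP v0.
  by apply/eqP/rowP => j; rewrite mxE; apply/eqP; rewrite -[_ == _]negbK.
case: (@arg_maxP _ _ _ j predT (fun k => `|v 0 k|)) => // i _ i_max.
have vi0 : 0 < `|v 0 i| by apply: lt_le_trans (i_max j isT); rewrite normr_gt0.
rewrite leNgt; apply/negP => a_lt0.
pose d : R := (degree (enum_val i))%:R.
have /rowP/(_ i) := vL; rewrite mulmxBr mul_mx_diag !mxE -/d => vLi.
have : `|(d - a) * v 0 i| <= d * `|v 0 i|.
  have -> : (d - a) * v 0 i = \sum_k v 0 k * adjacency_mx R G k i.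
    by rewrite mulrBl -vLi; ring.
  apply: le_trans (ler_norm_sum _ _ _) _.
  rewrite /d -sum_adj -(sum_enum_val (fun y => (adj (enum_val i) y)%:R)).
  rewrite mulr_suml.
  apply: ler_sum => k _; rewrite mxE normrM normr_nat mulrC adj_sym.
  by apply: ler_wpM2l; [rewrite ler0n | apply: i_max].
have d0 : 0 <= d by rewrite ler0n.
by rewrite normrM gtr0_norm; nra.
Qed.

Lemma laplacian_spectrumE (R : rcfType) (G : sgraph) :
  (0 < #|G|)%N ->
  laplacian_spectrum R G = 0 :: behead (laplacian_spectrum R G).
Proof.
move=> G_gt0; set s := laplacian_spectrum R G.
have s0 : 0 \in s.
  rewrite -root_prod_XsubC -char_poly_laplacian -eigenvalue_root_char.
  apply/eigenvalueP; exists (const_mx 1); last first.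
    apply/eqP => /rowP/(_ (Ordinal G_gt0)); rewrite !mxE => /eqP.
    by rewrite oner_eq0.
  (* [eigenvalue] is about row vectors, [laplacian_mul_ones] about a column; symmetry passes from
     one to the other. *)
  apply: trmx_inj; rewrite trmx_mul laplacian_tr trmx_const.
  by rewrite laplacian_mul_ones scale0r trmx0.
have := laplacian_spectrum_sorted R G; rewrite -/s.
case E: s s0 => [//|a t] s0 /= at_sorted; congr (_ :: _); apply/eqP.
rewrite eq_le (@laplacian_root_ge0 R G) ?andbT; last first.
  by rewrite char_poly_laplacian root_prod_XsubC -/s E mem_head.
move: s0; rewrite inE => /orP[/eqP <- //|t0].
by have /allP/(_ _ t0) := order_path_min le_trans at_sorted.
Qed.

Lemma size_laplacian_spectrum (R : rcfType) (G : sgraph) :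
  size (laplacian_spectrum R G) = #|G|.
Proof.
have /(congr1 (fun p : {poly R} => size p)) := char_poly_laplacian R G.
by rewrite size_char_poly size_prod_XsubC => -[].
Qed.

Lemma prod_laplacian_eigenvalue (S : pzSemiRingType) (R : rcfType) (G : sgraph)
    (F : R -> S) :
  (0 < #|G|)%N ->
  \prod_(a <- laplacian_spectrum R G) F a
    = F 0 * \prod_(2 <= i < #|G|.+1) F (laplacian_eigenvalue R G i).
Proof.
move=> G_gt0; rewrite (big_nth 0) size_laplacian_spectrum big_ltn //.
congr (_ * _); first by rewrite laplacian_spectrumE.
by rewrite [RHS]big_add1.
Qed.

(** * Determinants and incidence matrices *)

(** Two enumerations of [T] differ by one permutation, acting on rows and columns alike, so its sign
    enters squared. *)
Lemma det_reindex (K : comPzRingType) (T : finType) (f : T -> T -> K) n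
    (h : 'I_n -> T) :
  bijective h ->
  \det (\matrix_(i, j) f (h i) (h j))
    = \det (\matrix_(i < #|T|, j < #|T|) f (enum_val i) (enum_val j)).
Proof.
move=> h_bij; have nT := bij_eq_card h_bij; rewrite card_ord in nT.
move/esym: nT => nT; case: n / nT h h_bij => h h_bij; pose k i := enum_rank (h i).
have k_inj : injective k by move=> i j /enum_rank_inj /(bij_inj h_bij).
pose s := perm k_inj.
have -> : \matrix_(i, j) f (h i) (h j)
    = row_perm s (col_perm s (\matrix_(i, j) f (enum_val i) (enum_val j))).
  by apply/matrixP => i j; rewrite !mxE !permE !enum_rankK.
rewrite row_permE col_permE !det_mulmx !det_perm odd_permV mulrCA -expr2.
by rewrite sqrr_sign mulr1.
Qed.

(** Column elimination by a unipotent block matrix. A solution [W] stands in for the inverse of [D]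
    times [V]: for the join it can be written down without inverting the block of [G2]. *)
Lemma det_block_schur (K : comNzRingType) m n (A : 'M[K]_m) (U : 'M_(m, n))
    (V : 'M_(n, m)) (D : 'M_n) (W : 'M_(n, m)) :
  D *m W = V -> \det (block_mx A U V D) = \det (A - U *m W) * \det D.
Proof.
move=> DW; have E : block_mx A U V D *m block_mx 1%:M 0 (- W) 1%:M
    = block_mx (A - U *m W) U 0 D.
  by rewrite mulmx_block !mulmx1 !mulmx0 !mulmxN DW subrr !add0r.
by rewrite -(det_ublock _ U) -E det_mulmx det_lblock !det1 !mulr1.
Qed.

(* [det (1 - w u) = 1 - u w]: both are the determinant of the same bordered matrix. *)
Lemma det_sub_rank1 (K : comNzRingType) n (w : 'cV[K]_n) (u : 'rV_n) :
  \det (1%:M - w *m u) = 1 - (u *m w) 0 0.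
Proof.
have := det_block_schur 1%:M w (mul1mx u).
rewrite det1 mulr1 => <-.
have E : block_mx 1%:M 0 (- u) 1%:M *m block_mx 1%:M w u 1%:M
    = block_mx 1%:M w 0 (1%:M - u *m w).
  rewrite mulmx_block !mul1mx !mul0mx !addr0 mulmx1 addNr mulNmx.
  by rewrite [- _ + _]addrC.
have := congr1 determinant E.
rewrite det_mulmx det_lblock det_ublock !det1 !mul1r => ->.
by rewrite det_mx11 !mxE.
Qed.

(** Since [P] maps the all-ones column to [p] times itself, the constant matrix is a left multiple
    of [P]; factoring [P] out leaves a rank-one perturbation of the identity. *)
Lemma det_sub_const (K : fieldType) n (P : 'M[K]_n) (p c : K) :
  p != 0 -> P *m const_mx 1 = const_mx p :> 'cV_n ->
  \det (P - const_mx c) = \det P * (1 - n%:R * c / p).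
Proof.
move=> p0 P1.
have -> : P - const_mx c
    = P *m (1%:M - (const_mx 1 : 'cV_n) *m (const_mx (c / p) : 'rV_n)).
  rewrite mulmxBr mulmx1 mulmxA P1; congr (_ - _).
  apply/matrixP => i j; rewrite !mxE big_ord1 !mxE mulrCA.
  by rewrite divff // mulr1.
rewrite det_mulmx det_sub_rank1 !mxE; congr (_ * (1 - _)).
under eq_bigr do rewrite !mxE mulr1.
by rewrite sumr_const card_ord -mulrA mulr_natl.
Qed.

Section Incidence.
Variables (K : comNzRingType) (G : sgraph).

Definition edge_type : finType := {e : {set G} | e \in edges G}.

Definition incidence_mx : 'M[K]_(#|G|, #|edge_type|) :=
  \matrix_(i, j) (enum_val i \in val (enum_val j : edge_type))%:R.

(** The map sending [w] to [[set v; w]] is a bijection from the neighbours of [v] onto the edges at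
    [v]; its injectivity uses that there are no loops. *)
Lemma degreeE (v : G) : degree v = #|[set e : edge_type | v \in val e]|.
Proof.
rewrite /degree -(card_imset _ val_inj).
have /card_in_imset <- : {in [set w | adj v w] &, injective (fun w => [set v; w])}.
  move=> w w'; rewrite !inE => vw vw' /setP/(_ w); rewrite !inE eqxx orbT.
  case: eqP => [wv|_ /esym/eqP //]; by rewrite wv adj_irrefl in vw.
congr #|pred_of_set _|; apply/setP => e; apply/imsetP/imsetP => [[w]|[e']].
  rewrite inE => vw ->.
  have eE : [set v; w] \in edges G.
    by rewrite inE; apply/existsP; exists v; apply/existsP; exists w; rewrite vw eqxx.
  by exists (exist _ [set v; w] eE); rewrite // inE /= ?set21.
rewrite inE => + ->; case: e' => e' /= e'E v_e'.
move: (e'E); rewrite inE => /existsP[x /existsP[y /andP[xy /eqP e'xy]]].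
move: v_e'; rewrite e'xy !inE => /orP[/eqP -> | /eqP ->].
  by exists y; rewrite ?inE.
by exists x; rewrite ?inE 1?adj_sym // setUC.
Qed.

Lemma card_edges2 (v w : G) : v != w ->
  #|[set e : edge_type | (v \in val e) && (w \in val e)]| = adj v w.
Proof.
move=> vw; rewrite -(card_imset _ val_inj).
have E (e : {set G}) : e \in edges G -> v \in e -> w \in e -> adj v w /\ e = [set v; w].
  rewrite inE => /existsP[x /existsP[y /andP[xy /eqP ->]]].
  rewrite !inE => /orP[]/eqP vE /orP[]/eqP wE; subst.
  - by rewrite eqxx in vw.
  - by [].
  - by rewrite adj_sym setUC.
  - by rewrite eqxx in vw.
have [avw|Navw] := boolP (adj v w).
  apply/eqP/cards1P; exists [set v; w]; apply/setP => e; rewrite inE.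
  apply/imsetP/eqP => [[[e' e'E]]|->].
    by rewrite inE /= => /andP[ve we] ->; case: (E _ e'E ve we).
  have eE : [set v; w] \in edges G.
    by rewrite inE; apply/existsP; exists v; apply/existsP; exists w; rewrite avw eqxx.
  by exists (exist _ [set v; w] eE); rewrite // inE /= ?set21 ?set22.
apply/eqP; rewrite cards_eq0; apply/eqP/setP => e; rewrite inE.
apply/imsetP => -[[e' e'E]]; rewrite inE /= => /andP[ve we] _.
by case: (E _ e'E ve we) Navw => ->.
Qed.

(** Each entry counts the edges containing both vertices. The product is the signless Laplacian D +
    A, which for an r-regular graph equals 2 r I - L. *)
Lemma incidence_mul_tr (i j : 'I_#|G|) :
  (incidence_mx *m incidence_mx^T) i j
    = (if i == j then degree (enum_val i) else adj (enum_val i) (enum_val j))%:R.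
Proof.
rewrite mxE; under eq_bigr do rewrite !mxE -natrM mulnb.
rewrite (sum_enum_val (fun e : edge_type =>
  ((enum_val i \in val e) && (enum_val j \in val e))%:R)).
rewrite -natr_sum; congr (_%:R).
have -> (b : edge_type -> bool) : (\sum_e b e = #|[set e | b e]|)%N.
  rewrite -sum1_card [RHS]big_mkcond; apply: eq_bigr => e _; rewrite inE.
  by case: (b e).
case: eqP => [<-|/eqP ij]; last by rewrite card_edges2 // (inj_eq enum_val_inj).
by rewrite degreeE; apply: eq_card => e; rewrite !inE andbb.
Qed.

End Incidence.

(** * The Laplacian of the subdivision-vertex join *)

(* [x I - L(G)], indexed by vertices so that it can be reindexed by blocks. *)
Definition xsub_laplacian (K : pzRingType) (x : K) (G : sgraph) (u v : G) : K :=
  if u == v then x - (degree u)%:R else (adj u v)%:R.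

Definition xsub_laplacian_mx (K : pzRingType) (x : K) (G : sgraph) : 'M[K]_#|G| :=
  \matrix_(i, j) xsub_laplacian x (enum_val i) (enum_val j).

(** The point may lie outside [R]: it is later a rational function over [R], such as the
    indeterminate. *)
Lemma horner_char_poly (R K : comNzRingType) (f : {rmorphism R -> K}) n
    (M : 'M[R]_n) x :
  (map_poly f (char_poly M)).[x] = \det (x%:M - map_mx f M).
Proof.
rewrite map_char_poly /char_poly -horner_evalE -det_map_mx; congr (\det _).
apply/matrixP => i j; rewrite !mxE /=.
by rewrite horner_evalE hornerD hornerN hornerC hornerMn hornerX.
Qed.

Lemma det_xsub_laplacian (R : rcfType) (K : comNzRingType) (f : {rmorphism R -> K})
    (G : sgraph) (x : K) :
  \det (xsub_laplacian_mx x G) = (map_poly f (char_poly (laplacian R G))).[x].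
Proof.
rewrite horner_char_poly; congr (\det _); apply/matrixP => i j.
rewrite !mxE /xsub_laplacian (inj_eq enum_val_inj) rmorphB.
case: eqP => [<-|_]; first by rewrite adj_irrefl !mulr1n rmorph_nat rmorph0 subr0.
by rewrite !mulr0n rmorph0 rmorph_nat !sub0r opprK.
Qed.

Lemma det_xsub_laplacian_spectrum (R : rcfType) (K : comNzRingType)
    (f : {rmorphism R -> K}) (G : sgraph) (x : K) :
  \det (xsub_laplacian_mx x G) = \prod_(a <- laplacian_spectrum R G) (x - f a).
Proof.
rewrite (det_xsub_laplacian f) char_poly_laplacian rmorph_prod horner_prod.
by apply: eq_bigr => a _; rewrite rmorphB /= map_polyX map_polyC /= !hornerE.
Qed.

Lemma xsub_laplacian_mx_ones (K : pzRingType) (x : K) (G : sgraph) :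
  xsub_laplacian_mx x G *m const_mx 1 = const_mx x :> 'cV_#|G|.
Proof.
apply/matrixP => i j; rewrite !mxE; under eq_bigr do rewrite !mxE mulr1.
rewrite (sum_enum_val (xsub_laplacian x (enum_val i))).
set v := enum_val i; rewrite (bigD1 v) //= /xsub_laplacian eqxx.
rewrite -sum_adj (bigD1 v) //= adj_irrefl add0r.
rewrite [X in _ + X](eq_bigr (fun u => (adj v u)%:R)) ?subrK // => u.
by rewrite eq_sym => /negPf ->.
Qed.

Lemma split_lshift p q (k : 'I_p) : split (lshift q k) = inl k.
Proof. exact: (unsplitK (inl k)). Qed.

Lemma split_rshift p q (k : 'I_q) : split (rshift p k) = inr k.
Proof. exact: (unsplitK (inr k)). Qed.

Section Join.
Variables G1 G2 : sgraph.

Let n1 := #|G1|.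
Let n2 := #|G2|.
Let m := #|edge_type G1|.

Lemma degree_sum (G : sgraph) (v : G) : degree v = (\sum_w adj v w)%N.
Proof. by rewrite -[LHS]natn -sum_adj; apply: eq_bigr => w _; rewrite natn. Qed.

Lemma card_edge (e : edge_type G1) : #|val e| = 2%N.
Proof.
case: e => e /=; rewrite inE => /existsP[x /existsP[y /andP[xy /eqP ->]]].
by rewrite cards2; case: eqP xy => // ->; rewrite adj_irrefl.
Qed.

Lemma degree_join_vertex (v : G1) :
  degree (inl (inl v) : subdiv_vertex_join G1 G2) = (degree v + n2)%N.
Proof.
rewrite degree_sum !big_sumType /= big1 // add0n sum1_card; congr (_ + _)%N.
rewrite degreeE -sum1_card [RHS]big_mkcond; apply: eq_bigr => e _.
by rewrite inE; case: (v \in _).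
Qed.

Lemma degree_join_edge (e : edge_type G1) :
  degree (inl (inr e) : subdiv_vertex_join G1 G2) = 2%N.
Proof.
rewrite degree_sum !big_sumType /= [X in (_ + X + _)%N]big1 //.
rewrite [X in (_ + X)%N]big1 // !addn0 -(card_edge e) -sum1_card.
by rewrite [RHS]big_mkcond; apply: eq_bigr => v _; case: (v \in _).
Qed.

Lemma degree_join_right (u : G2) :
  degree (inr u : subdiv_vertex_join G1 G2) = (n1 + degree u)%N.
Proof.
by rewrite degree_sum !big_sumType /= sum1_card big1 ?addn0 // -degree_sum.
Qed.

(** The bracketing puts the edge vertices and the vertices of [G2], which are eliminated together,
    into one lower right block. *)
Definition join_vertex (i : 'I_(n1 + (m + n2))) : subdiv_vertex_join G1 G2 :=
  match split i with
  | inl i1 => inl (inl (enum_val i1))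
  | inr i' => match split i' with
              | inl e => inl (inr (enum_val e))
              | inr i2 => inr (enum_val i2)
              end
  end.

Definition join_rank (v : subdiv_vertex_join G1 G2) : 'I_(n1 + (m + n2)) :=
  match v with
  | inl (inl v1) => lshift _ (enum_rank v1)
  | inl (inr e) => rshift _ (lshift _ (enum_rank (e : edge_type G1)))
  | inr v2 => rshift _ (rshift _ (enum_rank v2))
  end.

Lemma join_vertex_bij : bijective join_vertex.
Proof.
exists join_rank; rewrite /join_vertex.
  move=> i; case: split_ordP => [i1 ->|i' ->] /=; first by rewrite enum_valK.
  by case: split_ordP => [e ->|i2 ->] /=; rewrite enum_valK.
by case=> [[v|e]|u] /=; rewrite ?(split_lshift, split_rshift) enum_rankK.
Qed.

(** Regularity makes the first diagonal block scalar. Each vertex of [G2] gains [n1] neighbours,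
    which shifts the argument of its block to [x - n1]. *)
Lemma det_join_block (K : comNzRingType) (x : K) (r : nat) : regular G1 r ->
  \det (xsub_laplacian_mx x (subdiv_vertex_join G1 G2))
  = \det (block_mx (x - (r + n2)%:R)%:M (row_mx (incidence_mx K G1) (const_mx 1))
      (col_mx (incidence_mx K G1)^T (const_mx 1))
      (block_mx (x - 2)%:M 0 0 (xsub_laplacian_mx (x - n1%:R) G2))).
Proof.
move=> G1r; rewrite -(det_reindex (@xsub_laplacian _ x _) join_vertex_bij).
congr (\det _); apply/matrixP => i j; rewrite !mxE /join_vertex /xsub_laplacian.
case: (split_ordP i) => [i1 _|i' _]; rewrite mxE;
  case: (split_ordP j) => [j1 _|j' _].
- rewrite !mxE !(inj_eq inl_inj) (inj_eq enum_val_inj) degree_join_vertex G1r /=.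
  by case: eqP; rewrite ?mulr1n ?mulr0n.
- by rewrite !mxE; case: (split_ordP j') => [f _|j2 _]; rewrite !mxE.
- by rewrite !mxE; case: (split_ordP i') => [e _|i2 _]; rewrite !mxE.
rewrite !mxE; case: (split_ordP i') => [e _|i2 _]; rewrite !mxE;
  case: (split_ordP j') => [f _|j2 _] //=; rewrite ?mxE //.
- rewrite (inj_eq inl_inj) (inj_eq inr_inj) (inj_eq enum_val_inj) degree_join_edge.
  by case: eqP; rewrite ?mulr1n ?mulr0n.
rewrite (inj_eq inr_inj) degree_join_right /xsub_laplacian.
by rewrite natrD opprD addrA.
Qed.

Lemma det_join (K : fieldType) (x : K) (r : nat) (a := x - (r + n2)%:R)
    (b := x - 2) (q := x - n1%:R) (y := a * b - (2 * r)%:R) :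
  b != 0 -> q != 0 -> y != 0 -> regular G1 r ->
  \det (xsub_laplacian_mx x (subdiv_vertex_join G1 G2))
  = b ^+ m * (- b^-1) ^+ n1 * (1 - (n1 * n2)%:R * b / (q * y))
    * \det (xsub_laplacian_mx (- y) G1) * \det (xsub_laplacian_mx q G2).
Proof.
move=> b0 q0 y0 G1r; rewrite (det_join_block x G1r) -/a -/b -/q.
(* The edge block is [b] times the identity, and the block of [G2] multiplies the all-ones vector by
   [q]. *)
pose W := col_mx (b^-1 *: (incidence_mx K G1)^T) (const_mx q^-1 : 'M_(n2, n1)).
rewrite (det_block_schur _ _ (W := W)); last first.
  rewrite /W mul_block_col !mul0mx addr0 add0r mul_scalar_mx scalerA divff //.
  rewrite scale1r; congr col_mx.
  have -> : const_mx q^-1 = const_mx 1 *m (const_mx q^-1 : 'rV[K]_n1) :> 'M_(n2, n1).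
    by apply/matrixP => i j; rewrite !mxE big_ord1 !mxE mul1r.
  rewrite mulmxA xsub_laplacian_mx_ones.
  by apply/matrixP => i j; rewrite !mxE big_ord1 !mxE divff.
rewrite det_ublock det_scalar mul_row_col.
have -> : const_mx 1 *m (const_mx q^-1 : 'M_(n2, n1))
    = const_mx (n2%:R / q) :> 'M[K]_n1.
  apply/matrixP => i j; rewrite !mxE; under eq_bigr do rewrite !mxE mul1r.
  by rewrite sumr_const card_ord mulr_natl.
rewrite -scalemxAr opprD addrA.
(* On the diagonal, a - r / b = (y + r) / b because a b = y + 2 r. *)
have -> : a%:M - b^-1 *: (incidence_mx K G1 *m (incidence_mx K G1)^T)
    = - b^-1 *: xsub_laplacian_mx (- y) G1.
  apply/matrixP => i j; rewrite [LHS]mxE [X in _ + X]mxE [X in _ - X]mxE.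
  rewrite incidence_mul_tr !mxE /xsub_laplacian (inj_eq enum_val_inj) !G1r.
  case: eqP => _; last by rewrite mulr0n sub0r mulNr.
  by rewrite mulr1n /y; field.
rewrite (det_sub_const (p := y / b)) ?mulf_neq0 ?invr_neq0 //; last first.
  rewrite -scalemxAl xsub_laplacian_mx_ones.
  by apply/matrixP => i j; rewrite !mxE; field.
rewrite detZ natrM.
have -> : n1%:R * (n2%:R / q) / (y / b) = n1%:R * n2%:R * b / (q * y)
  by field; rewrite b0 q0 y0.
move: (_ ^+ n1) (_ ^+ m) (\det _) (\det _) (1 - _) => u v d1 d2 c.
by ring.
Qed.

End Join.

(** * Assembly in the field of rational functions *)

Lemma polyX2_sub_neq0 (R : nzRingType) (c d : R) : 'X^2 - c *: 'X + d%:P != 0.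
Proof.
apply/eqP => /(congr1 (fun p : {poly R} => p`_2)); rewrite !coefE /=.
by rewrite mulr0 subr0 addr0 => /eqP; rewrite oner_eq0.
Qed.

(** Lets a characteristic polynomial be computed as a determinant over the fraction field, where the
    elimination may divide by [b], [q] and [y]. *)
Lemma tofrac_horner (R : idomainType) (p : {poly R}) :
  (map_poly (@tofrac {poly R} \o @polyC R) p).['X%:F] = p%:F.
Proof. by rewrite map_poly_comp horner_map -[RHS](congr1 _ (comp_polyXr p)). Qed.

Lemma prod_opp_seq (K : comPzRingType) (I : Type) (s : seq I) (F : I -> K) :
  \prod_(a <- s) - F a = (-1) ^+ size s * \prod_(a <- s) F a.
Proof.
elim: s => [|a s IHs]; first by rewrite !big_nil mulr1.
by rewrite !big_cons IHs exprS mulrACA mulN1r.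
Qed.

(** The factors [y] and [q] contributed by the eigenvalue 0 of each graph clear the denominator
    [q * y]. What remains, q y - n1 n2 b, vanishes at x = 0 and equals [x] times the quadratic of
    the theorem. *)
Lemma factor_assembly (K : fieldType) (x : K) (n1 n2 m r : nat) (P1 P2 : K)
    (b := x - 2) (q := x - n1%:R) (y := (x - (r + n2)%:R) * b - (2 * r)%:R) :
  b != 0 -> q != 0 -> y != 0 ->
  b ^+ m * (- b^-1) ^+ n1 * (1 - (n1 * n2)%:R * b / (q * y))
    * ((-1) ^+ n1 * (y * P1)) * (q * P2)
  = x * b ^ (m%:Z - n1%:Z)
    * (x ^+ 2 - (2 + r + n1 + n2)%:R * x + (2 * n1 + 2 * n2 + n1 * r)%:R)
    * P2 * P1.
Proof.
move=> b0 q0 y0.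
have -> : b ^ (m%:Z - n1%:Z) = b ^+ m / b ^+ n1.
  by rewrite expfzDr // -exprnN.
rewrite (exprNn b^-1) exprVn; set s := (-1) ^+ n1.
(* One sign comes from the powers of [- b^-1], the other from evaluating at [- y]. *)
have ss : s * s = 1 by rewrite -expr2 sqrr_sign.
move: (b ^+ m) (b ^+ n1)^-1 => u v.
transitivity (u * v * (q * y - (n1 * n2)%:R * b) * P1 * P2 * (s * s)).
  by field; rewrite q0 y0.
by rewrite ss /q /y /b; ring.
Qed.

Unset Implicit Arguments.

Theorem theorem2p8 (R : rcfType) (G1 G2 : sgraph) (n1 m1 n2 r1 : nat)
    (n1_gt0 : (0 < n1)%N) (n2_gt0 : (0 < n2)%N)
    (card_V1 : #|G1| = n1) (card_E1 : #|edges G1| = m1) (card_V2 : #|G2| = n2)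
    (G1_regular : regular G1 r1) :
  (char_poly (laplacian R (subdiv_vertex_join G1 G2)))%:F =
    'X%:F * ('X - 2%:P)%:F ^ (m1%:Z - n1%:Z)
    * ('X^2 - (2 + r1 + n1 + n2)%:R *: 'X
       + (2 * n1 + 2 * n2 + n1 * r1)%:R%:P)%:F
    * (\prod_(2 <= i < n2.+1)
         ('X - n1%:R%:P - (laplacian_eigenvalue R G2 i)%:P))%:F
    * (\prod_(2 <= i < n1.+1)
         ('X^2 - (2 + r1 + n2)%:R *: 'X
          + ((2 * n2)%:R + laplacian_eigenvalue R G1 i)%:P))%:F
  :> {fraction {poly R}}.
Proof.
subst n1 m1 n2.
pose f : {rmorphism R -> {fraction {poly R}}} := @tofrac {poly R} \o @polyC R.
have fC (c : R) : (c%:P)%:F = f c by [].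
have fn k : (k%:R%:P : {poly R})%:F = k%:R by rewrite polyC_natr rmorph_nat.
pose x : {fraction {poly R}} := 'X%:F.
pose b := x - 2; pose q := x - #|G1|%:R.
pose y := (x - (r1 + #|G2|)%:R) * b - (2 * r1)%:R.
have bE : ('X - 2%:P)%:F = b by rewrite rmorphB /= fn.
have qE : ('X - #|G1|%:R%:P)%:F = q by rewrite rmorphB /= fn.
have yE c : ('X^2 - (2 + r1 + #|G2|)%:R *: 'X + ((2 * #|G2|)%:R + c)%:P)%:F = y + f c.
  rewrite rmorphD rmorphB /= rmorphXn /= -mul_polyC rmorphM /= !fn polyCD rmorphD /=.
  by rewrite fn fC -/x /y /b; ring.
have b0 : b != 0 by rewrite -bE tofrac_eq0 polyXsubC_eq0.
have q0 : q != 0 by rewrite -qE tofrac_eq0 polyXsubC_eq0.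
(* [y] is the case [c = 0] of [yE], hence the image of a monic quadratic. *)
have y0 : y != 0 by rewrite -[y]addr0 -(rmorph0 f) -yE tofrac_eq0 polyX2_sub_neq0.
rewrite -[LHS]tofrac_horner -(det_xsub_laplacian f) -/x.
rewrite (det_join b0 q0 y0 G1_regular) !(det_xsub_laplacian_spectrum f).
under [X in _ * X * _]eq_bigr do rewrite -opprD.
rewrite prod_opp_seq size_laplacian_spectrum !prod_laplacian_eigenvalue //.
rewrite rmorph0 !(addr0, subr0) bE !rmorph_prod /=.
under [X in _ = _ * X * _]eq_bigr do rewrite rmorphB /= qE fC.
under [X in _ = _ * X]eq_bigr do rewrite yE.
set P1 := \prod_(_ <= _ < _) _; set P2 := \prod_(_ <= _ < _) _.
have -> : ('X^2 - (2 + r1 + #|G1| + #|G2|)%:R *: 'X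
    + (2 * #|G1| + 2 * #|G2| + #|G1| * r1)%:R%:P)%:F
  = x ^+ 2 - (2 + r1 + #|G1| + #|G2|)%:R * x
    + (2 * #|G1| + 2 * #|G2| + #|G1| * r1)%:R.
  by rewrite rmorphD rmorphB /= rmorphXn /= -mul_polyC rmorphM /= !fn.
(* The exponent in [det_join] is the cardinality of the type of edges, here that of the set
   [edges G1]. *)
rewrite -(factor_assembly _ _ _ b0 q0 y0) -(card_sig (mem (edges G1))).
by [].
Qed.
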